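(* Let $n\ge1$, $0\le\ell\le2n$, $\lambda=\max\{\ell,2n-\ell\}$, and let $\varphi^{AE}$ be any density operator on $\mathcal H_A\otimes\mathcal H_E$ with $\mathcal H_A=(\mathbb C^2)^{\otimes n}$ and $\mathcal H_E$ finite-dimensional. Then $$\mathbb E_{u,v}\big\|R_{uv}(\varphi^{AE})-\tau^A\otimes\varphi^E\big\|_1\;\le\;\sqrt{2^{\,n-\ell-\mathsf H_2(A|E)_\varphi}},$$ where $u$ is uniform on $\{0,1\}^\lambda$, $v$ uniform on $\{0,1\}^{2n-\ell}$, $\tau^A=\mathbb 1_A/2^n$, $\varphi^E=\mathrm{Tr}_A\varphi^{AE}$, and $\|M\|_1=\mathrm{Tr}\sqrt{M^\dagger M}$.
   Context: Let $X=\begin{pmatrix}0&1\\1&0\end{pmatrix}$, $Z=\begin{pmatrix}1&0\\0&-1\end{pmatrix}$. For $\beta=s\|q\in\{0,1\}^{2n}$ ($s,q\in\{0,1\}^n$) let $U_\beta=\bigotimes_{i=1}^nX^{s_i}Z^{q_i}$ and $F_\beta(\rho)=(U_\beta\otimes\mathbb 1_E)\rho(U_\beta^\dagger\otimes\mathbb 1_E)$. Bit strings are identified with elements of $\mathrm{GF}(2^\lambda)$ via the polynomial representation; $(w)_{\rm lsb}$ denotes the last $2n-\ell$ bits of $w$ (the polynomial modulo $x^{2n-\ell}$). For $k\in\{0,1\}^\ell$, $u\in\{0,1\}^\lambda$, $v\in\{0,1\}^{2n-\ell}$, $b(k,u,v)=k\,\|\,((uk)_{\rm lsb}+v)$ (concatenation;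 product in $\mathrm{GF}(2^\lambda)$; $+$ is XOR), and $R_{uv}(\varphi^{AE})=2^{-\ell}\sum_{k\in\{0,1\}^\ell}F_{b(k,u,v)}(\varphi^{AE})$. Conditional collision entropy (sandwiched Rényi, order 2): for $\rho,\sigma\ge0$, $\rho\ne0$, $D_2(\rho\|\sigma)=\log_2\mathrm{Tr}\big[(\sigma^{-1/4}\rho\,\sigma^{-1/4})^2\big]$ if the kernel of $\sigma$ is contained in the kernel of $\rho$, and $+\infty$ otherwise; and $\mathsf H_2(A|E)_\varphi=-\inf_{\sigma_E}D_2(\varphi^{AE}\|\mathbb 1_A\otimes\sigma_E)$, the infimum over density operators $\sigma_E$ on $\mathcal H_E$. *)

(* Defs.v *)
From HB Require Import structures.
From mathcomp Require Import all_boot all_order all_algebra all_field.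
From mathcomp Require Import all_classical all_reals all_analysis.
From mathcomp Require Import complex mxtens.
Set Implicit Arguments. Unset Strict Implicit. Unset Printing Implicit Defensive.
Import Order.TTheory GRing.Theory Num.Theory ComplexField.
Local Open Scope ring_scope.
Local Open Scope complex_scope.

Section QDefs.
Variable R : realType.
Local Notation C := R[i].

Definition adj m n (M : 'M[C]_(m, n)) : 'M[C]_(n, m) := (map_mx (@conjc R) M)^T.

Definition unitary m (U : 'M[C]_m) := U *m adj U = 1%:M /\ adj U *m U = 1%:M.

Definition spectral_decomp m (A : 'M[C]_m) (Ud : 'M[C]_m * ('I_m -> R)) :=
  unitary Ud.1 /\ A = Ud.1 *m diag_mx (\row_i ((Ud.2 i)%:C)) *m adj Ud.1.

(* functional calculus f(A) for Hermitian A (via a chosen spectral decomposition;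
   0 if A has no spectral decomposition, i.e. is not Hermitian) *)
Definition fun_mx (f : R -> R) m (A : 'M[C]_m) : 'M[C]_m :=
  match pselect (exists Ud, spectral_decomp A Ud) with
  | left H => let Ud := projT1 (cid H) in
              Ud.1 *m diag_mx (\row_i ((f (Ud.2 i))%:C)) *m adj Ud.1
  | right _ => 0
  end.

Definition psd m (A : 'M[C]_m) :=
  A = adj A /\ forall v : 'cV[C]_m, 0 <= (adj v *m A *m v) 0 0.
Definition density m (A : 'M[C]_m) := psd A /\ \tr A = 1.

Definition trnorm m (M : 'M[C]_m) : R := complex.Re (\tr (fun_mx Num.sqrt (adj M *m M))).

Definition log2 (x : R) : R := ln x / ln 2.

Definition ker_sub m (s r : 'M[C]_m) := forall v : 'cV[C]_m, s *m v = 0 -> r *m v = 0.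

(* x^{-1/4} on the support (generalised inverse) *)
Definition inv_qrt (x : R) : R := if 0 < x then x `^ (- (4%:R)^-1) else 0.

Definition D2 m (rho sigma : 'M[C]_m) : \bar R :=
  if pselect (ker_sub sigma rho) then
    let s := fun_mx inv_qrt sigma in
    (log2 (complex.Re (\tr ((s *m rho *m s) ^+ 2))))%:E
  else +oo%E.

Definition H2 dA dE (phi : 'M[C]_(dA * dE)) : \bar R :=
  (- ereal_inf [set D2 phi ((1%:M : 'M[C]_dA) *t sigma) | sigma in [set s : 'M[C]_dE | density s]])%E.

Definition ptrA dA dE (phi : 'M[C]_(dA * dE)) : 'M[C]_dE :=
  \matrix_(i, j) \sum_(a < dA) phi (mxtens_index (a, i)) (mxtens_index (a, j)).

Definition pX : 'M[C]_2 := \matrix_(i, j) (i != j)%:R.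
Definition pZ : 'M[C]_2 := \matrix_(i, j) (if i == j then (if i == 0 then 1 else -1) else 0).
Definition pXZ (s q : bool) : 'M[C]_2 := (if s then pX else 1%:M) *m (if q then pZ else 1%:M).

(* U = \bigotimes_{i=1}^n X^{s_i} Z^{q_i}, first qubit = most significant tensor factor *)
Fixpoint paulis (n : nat) : ('I_n -> bool) -> ('I_n -> bool) -> 'M[C]_(2 ^ n) :=
  match n return ('I_n -> bool) -> ('I_n -> bool) -> 'M[C]_(2 ^ n) with
  | 0 => fun _ _ => 1%:M
  | n'.+1 => fun s q => castmx (esym (expnS 2 n'), esym (expnS 2 n'))
               (pXZ (s ord0) (q ord0) *t
                paulis (fun i => s (lift ord0 i)) (fun i => q (lift ord0 i)))
  end.

Definition Ubeta (n : nat) (beta : seq bool) : 'M[C]_(2 ^ n) :=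
  paulis (fun i : 'I_n => nth false beta i) (fun i : 'I_n => nth false beta (n + i)).

Definition Fbeta n dE (beta : seq bool) (rho : 'M[C]_(2 ^ n * dE)) : 'M[C]_(2 ^ n * dE) :=
  let W := Ubeta n beta *t (1%:M : 'M[C]_dE) in W *m rho *m adj W.

End QDefs.

(* bit string w_0 ... w_{m-1}  <->  polynomial sum_i w_i X^(m-1-i)
   (the last bits are the low-degree coefficients) *)
Definition bpoly (w : seq bool) : {poly 'F_2} :=
  \sum_(i < size w) (nth false w i)%:R *: 'X^(size w - i.+1).

Definition pbits (m : nat) (r : {poly 'F_2}) : seq bool :=
  [seq r`_(m - i.+1) == 1 | i <- iota 0 m].

Definition gfmul (p : {poly 'F_2}) (a b : seq bool) : {poly 'F_2} := (bpoly a * bpoly b) %% p.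

Definition lsb (m : nat) (w : {poly 'F_2}) : seq bool := pbits m (w %% 'X^m).

Definition xorb_seq (a b : seq bool) : seq bool := [seq x.1 (+) x.2 | x <- zip a b].

Definition bkuv (p : {poly 'F_2}) (n l : nat) (k u v : seq bool) : seq bool :=
  k ++ xorb_seq (lsb (2 * n - l) (gfmul p u k)) v.

Definition Ruv (R : realType) (p : {poly 'F_2}) (n l dE : nat) (u v : seq bool)
  (phi : 'M[R[i]]_(2 ^ n * dE)) : 'M[R[i]]_(2 ^ n * dE) :=
  (2 ^ l)%:R^-1 *: \sum_(k : l.-tuple bool) Fbeta (bkuv p n l k u v) phi.

(* Main.v *)
Require Import Defs.
From HB Require Import structures.
From mathcomp Require Import all_boot all_order all_algebra all_field.
From mathcomp Require Import all_classical all_reals all_analysis.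
From mathcomp Require Import complex mxtens.
From mathcomp Require Import ring lra zify.
Import Order.TTheory GRing.Theory Num.Theory ComplexField.
Set Implicit Arguments. Unset Strict Implicit. Unset Printing Implicit Defensive.
Local Open Scope ring_scope.

(* Fix a state [sigma] on E, put [w := 1 (x) sigma] and [Delta := R_uv(phi) - tau (x) phi_E].
   If [h = w^(1/4)] and [s = w^(-1/4)] (on the support), the kernel condition gives
   [Delta = h (s Delta s) h], and Cauchy-Schwarz for the Hilbert-Schmidt product, applied to the
   polar decomposition of [Delta], yields [|Delta|_1 ^ 2 <= Tr w * |s Delta s|_2 ^ 2] with
   [Tr w = 2^n]. The Pauli operators act on A only, so they commute with [s], and their uniform
   average sends [phi] to [tau (x) phi_E]. The map [(u, v) |-> (uk)_lsb + v] is strongly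
   two-universal: for [k != k'] the two masks are independent and uniform, so in the second moment
   of [s R_uv(phi) s] the off-diagonal terms are dominated by the squared mean, while the diagonal
   terms contribute [2^-l * |s phi s|_2 ^ 2]. Jensen's inequality and the infimum over [sigma]
   conclude. *)

(** * Hilbert-Schmidt geometry and functional calculus *)

Section Adjoint.
Local Open Scope complex_scope.
Variable R : realType.
Local Notation C := R[i].

Lemma adjE m n (A : 'M[C]_(m, n)) i j : adj A i j = conjc (A j i).
Proof. by rewrite !mxE. Qed.

Lemma adjK m n (A : 'M[C]_(m, n)) : adj (adj A) = A.
Proof. by apply/matrixP => i j; rewrite !adjE conjcK. Qed.

Lemma adj_mul m n p (A : 'M[C]_(m, n)) (B : 'M[C]_(n, p)) :
  adj (A *m B) = adj B *m adj A.
Proof. by rewrite /adj map_mxM trmx_mul. Qed.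

Lemma adj_id n : adj (1%:M : 'M[C]_n) = 1%:M.
Proof. by rewrite /adj map_mx1 trmx1. Qed.

Lemma adjZ m n c (A : 'M[C]_(m, n)) : adj (c *: A) = conjc c *: adj A.
Proof. by rewrite /adj map_mxZ linearZ. Qed.

Lemma adj_diag n (d : 'I_n -> R) :
  adj (diag_mx (\row_i (d i)%:C)) = diag_mx (\row_i (d i)%:C).
Proof.
apply/matrixP => i j; rewrite !mxE eq_sym.
by case: eqP => [->|_]; rewrite ?conjc_real ?mulr0n ?conjc0.
Qed.

Lemma adj_tens m n p q (A : 'M[C]_(m, n)) (B : 'M[C]_(p, q)) :
  adj (A *t B) = adj A *t adj B.
Proof. by rewrite /adj map_mxT trmx_tens. Qed.

(** The spectral theorem for normal matrices gives [A = P^-1 D P] with [P] unitary, so the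
    eigenvector matrix is [adj P]; hermiticity makes [D] real. *)
Lemma hermitian_spectral_decomp n (A : 'M[C]_n) :
  A = adj A -> exists Ud, spectral_decomp A Ud.
Proof.
move=> hA.
have AH : A \is hermsymmx.
  apply/is_hermitianmxP; rewrite expr0 scale1r; apply/matrixP => i j.
  by rewrite {1}hA !mxE.
have /hermitian_normalmx /orthomx_spectralP A_eq := AH.
have /mxOverP Dreal := hermitian_spectral_diag_real AH.
have /unitarymxP PP := spectral_unitarymx A.
have Pu := spectral_unit A.
have adjP : invmx (spectralmx A) = adj (spectralmx A).
  rewrite invmx_unitary ?spectral_unitarymx //.
  by apply/matrixP => i j; rewrite !mxE.
exists (adj (spectralmx A), fun i => complex.Re (spectral_diag A 0 i)); split => /=.
  by rewrite /unitary adjK -adjP mulVmx // mulmxV.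
rewrite adjK {1}A_eq -adjP; congr (_ *m diag_mx _ *m _).
by apply/rowP => i; rewrite !mxE RRe_real.
Qed.

(** Functional calculus relative to an explicit decomposition: several functions of one matrix then
    share an eigenbasis and multiply pointwise, whereas [fun_mx] hides its choice. *)
Definition spectral_fun n (f : R -> R) (Ud : 'M[C]_n * ('I_n -> R)) : 'M[C]_n :=
  Ud.1 *m diag_mx (\row_i (f (Ud.2 i))%:C) *m adj Ud.1.

Lemma fun_mxP f n (A : 'M[C]_n) : A = adj A ->
  exists2 Ud, spectral_decomp A Ud & fun_mx f A = spectral_fun f Ud.
Proof.
move=> hA; rewrite /fun_mx; case: pselect => [H|[]]; last exact: hermitian_spectral_decomp.
by case: (cid H) => /= Ud HUd; exists Ud.
Qed.

Section SpectralFun.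
Variables (n : nat) (A : 'M[C]_n) (Ud : 'M[C]_n * ('I_n -> R)).
Hypothesis AUd : spectral_decomp A Ud.

Lemma spectral_fun_id : spectral_fun id Ud = A.
Proof. by case: AUd => _ ->. Qed.

Lemma spectral_fun1 : spectral_fun (fun=> 1) Ud = 1%:M.
Proof.
case: AUd => -[U1 U2] _; rewrite /spectral_fun -[RHS]U1; congr (_ *m _).
rewrite -[RHS]mulmx1; congr (_ *m _).
by apply/matrixP => i j; rewrite !mxE.
Qed.

Lemma spectral_funM f g :
  spectral_fun f Ud *m spectral_fun g Ud = spectral_fun (fun x => f x * g x) Ud.
Proof.
case: AUd => -[U1 U2] _; rewrite /spectral_fun !mulmxA.
rewrite -[X in X *m diag_mx _ *m _ = _]mulmxA U2 mulmx1.
congr (_ *m _); rewrite -mulmxA; congr (_ *m _).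
rewrite mulmx_diag; congr diag_mx; apply/rowP => i.
by rewrite !mxE rmorphM.
Qed.

Lemma spectral_funB f g :
  spectral_fun f Ud - spectral_fun g Ud = spectral_fun (fun x => f x - g x) Ud.
Proof.
rewrite /spectral_fun -mulmxBl -mulmxBr; congr (_ *m _ *m _).
apply/matrixP => i j; rewrite !mxE.
by case: eqP => [->|_]; rewrite ?mulr0n ?subr0 // !mulr1n rmorphB.
Qed.

Lemma spectral_fun_adj f : adj (spectral_fun f Ud) = spectral_fun f Ud.
Proof. by rewrite /spectral_fun !adj_mul adjK adj_diag mulmxA. Qed.

Lemma eq_spectral_fun f g : (forall i, f (Ud.2 i) = g (Ud.2 i)) ->
  spectral_fun f Ud = spectral_fun g Ud.
Proof.
move=> fg; rewrite /spectral_fun; congr (_ *m diag_mx _ *m _).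
by apply/rowP => i; rewrite !mxE fg.
Qed.

(* In the eigenbasis, commuting with [A] means that the matrix entries between
   distinct eigenvalues vanish. *)
Lemma spectral_fun_comm f (B : 'M[C]_n) :
  B *m A = A *m B -> B *m spectral_fun f Ud = spectral_fun f Ud *m B.
Proof.
case: AUd => -[U1 U2] ->; rewrite /spectral_fun.
set U := Ud.1 in U1 U2 *; set D := diag_mx _; set D' := diag_mx _ => BA.
have : adj U *m B *m U *m D = D *m (adj U *m B *m U).
  have := congr1 (fun X => adj U *m X *m U) BA.
  by rewrite !mulmxA U2 mul1mx -[LHS]mulmxA U2 mulmx1 => ->.
set B' := adj U *m B *m U => B'D.
have B'D' : B' *m D' = D' *m B'.
  apply/matrixP => i j; move/matrixP/(_ i j): B'D.
  rewrite !mul_mx_diag !mul_diag_mx !mxE.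
  have [->|/eqP e] := eqVneq (Ud.2 i) (Ud.2 j); first by move=> _; rewrite mulrC.
  rewrite [X in _ = X]mulrC => /eqP; rewrite -subr_eq0 -mulrBr mulf_eq0 => /orP[/eqP->|].
    by rewrite mul0r mulr0.
  by rewrite subr_eq0 => /eqP [] /esym.
have EB : B = U *m B' *m adj U by rewrite /B' !mulmxA U1 mul1mx -mulmxA U1 mulmx1.
have conjM X Y : (U *m X *m adj U) *m (U *m Y *m adj U) = U *m (X *m Y) *m adj U.
  by rewrite !mulmxA -[X in X *m Y]mulmxA U2 mulmx1.
by rewrite EB !conjM B'D'.
Qed.

(** The quadratic form at the [i]-th column of the eigenbasis equals the [i]-th eigenvalue. *)
Lemma spectral_ge0 : (forall v : 'cV[C]_n, 0 <= (adj v *m A *m v) 0 0) ->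
  forall i, 0 <= Ud.2 i.
Proof.
case: AUd => -[U1 U2] EA H i; have := H (Ud.1 *m delta_mx i 0).
rewrite adj_mul {1}EA !mulmxA -[X in (X *m _ *m _ *m _ *m _) 0 0]mulmxA U2 mulmx1.
rewrite -[X in (X *m _) 0 0]mulmxA U2 mulmx1.
rewrite -mulmxA -colE mxE (bigD1 i) //= big1 => [|j /negPf ji].
  by rewrite adjE !mxE !eqxx /= oppr0 -[1 +i* 0]/(1 : C) mul1r addr0 mulr1n ler0c. 
by rewrite !mxE ji mulr0n mulr0.
Qed.
End SpectralFun.

(** Real part of the Hilbert-Schmidt product: a symmetric positive semidefinite [R]-bilinear form,
    which keeps all norm estimates in the ordered field [R]. *)
Definition ip m n (A B : 'M[C]_(m, n)) : R := complex.Re (\tr (adj A *m B)).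

Lemma ReD (x y : C) : complex.Re (x + y) = complex.Re x + complex.Re y.
Proof. by case: x y => [a b] []. Qed.

Lemma ReN (x : C) : complex.Re (- x) = - complex.Re x.
Proof. by case: x. Qed.

Lemma Re_conj (x : C) : complex.Re (conjc x) = complex.Re x.
Proof. by case: x. Qed.

Lemma ReZ (a : R) (x : C) : complex.Re (a%:C * x) = a * complex.Re x.
Proof. by case: x => x y /=; rewrite mul0r subr0. Qed.

Lemma tr_adj n (A : 'M[C]_n) : \tr (adj A) = conjc (\tr A).
Proof. by rewrite /mxtrace rmorph_sum; apply: eq_bigr => i _; rewrite adjE. Qed.

Lemma ipC m n (A B : 'M[C]_(m, n)) : ip A B = ip B A.
Proof. by rewrite /ip -Re_conj -tr_adj adj_mul adjK. Qed.

Lemma ipDr m n (A B D : 'M[C]_(m, n)) : ip A (B + D) = ip A B + ip A D.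
Proof. by rewrite /ip mulmxDr mxtraceD ReD. Qed.

Lemma ipNr m n (A B : 'M[C]_(m, n)) : ip A (- B) = - ip A B.
Proof. by rewrite /ip mulmxN raddfN /= ReN. Qed.

Lemma ipZr m n a (A B : 'M[C]_(m, n)) : ip A (a%:C *: B) = a * ip A B.
Proof. by rewrite /ip -scalemxAr mxtraceZ ReZ. Qed.

Lemma ip0r m n (A : 'M[C]_(m, n)) : ip A 0 = 0.
Proof. by rewrite /ip mulmx0 mxtrace0. Qed.

Lemma ip_sumr m n (A : 'M[C]_(m, n)) (I : Type) (r : seq I) (P : pred I) F :
  ip A (\sum_(i <- r | P i) F i) = \sum_(i <- r | P i) ip A (F i).
Proof. by elim/big_rec2 : _ => [|i x y _ <-]; rewrite ?ip0r ?ipDr. Qed.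

Lemma ip_suml m n (A : 'M[C]_(m, n)) (I : Type) (r : seq I) (P : pred I) F :
  ip (\sum_(i <- r | P i) F i) A = \sum_(i <- r | P i) ip (F i) A.
Proof. by rewrite ipC ip_sumr; apply: eq_bigr => i _; rewrite ipC. Qed.

Lemma ip_sqB m n (A B : 'M[C]_(m, n)) :
  ip (A - B) (A - B) = ip A A - 2 * ip A B + ip B B.
Proof.
rewrite ipDr ipNr [ip _ A]ipC [ip _ B]ipC !ipDr !ipNr [ip B A]ipC.
ring.
Qed.

Lemma ip_ge0 m n (A : 'M[C]_(m, n)) : 0 <= ip A A.
Proof.
rewrite /ip /mxtrace.
suff : 0 <= \sum_i (adj A *m A) i i by rewrite lecE => /andP[].
apply: sumr_ge0 => i _; rewrite mxE; apply: sumr_ge0 => j _.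
by rewrite adjE mulrC mulcJ_ge0.
Qed.

Lemma ip_CauchySchwarz m n (A B : 'M[C]_(m, n)) : ip A B ^+ 2 <= ip A A * ip B B.
Proof.
have key (a b : R) : 0 <= a ^+ 2 * ip A A - 2 * a * b * ip A B + b ^+ 2 * ip B B.
  have := ip_ge0 (a%:C *: A - b%:C *: B).
  rewrite ip_sqB !ipZr ![ip (_ *: _) _]ipC !ipZr [ip B A]ipC.
  by congr (_ <= _); ring.
have a0 := ip_ge0 A; have b0 := ip_ge0 B.
have [B0|/eqP B0] := eqVneq (ip B B) 0.
  (* With these coefficients [key] reads [0 <= - (ip A B)^2 (ip A A + 2)], which forces
     [ip A B = 0]. *)
  have := key (ip A B) (ip A A + 1); rewrite B0 mulr0 addr0.
  have [->|/eqP nz] := eqVneq (ip A B) 0; first by move=> _; rewrite expr0n mulr0.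
  have : 0 < ip A B ^+ 2 by rewrite exprn_even_gt0 //; apply/eqP.
  by set x := ip A B; set y := ip A A in a0 *; move=> h1 h2; nra.
have Bp : 0 < ip B B by rewrite lt_neqAle b0 andbT eq_sym; apply/eqP.
rewrite -subr_ge0 -(pmulr_rge0 _ Bp); have := key (ip B B) (ip A B).
by congr (_ <= _); ring.
Qed.

Lemma ip_mull m n p (A : 'M[C]_(m, p)) (B : 'M[C]_(m, n)) D :
  ip A (B *m D) = ip (adj B *m A) D.
Proof. by rewrite /ip adj_mul adjK mulmxA. Qed.

Lemma ip_mulr m n p (A : 'M[C]_(m, p)) (B : 'M[C]_(m, n)) D :
  ip A (B *m D) = ip (A *m adj D) B.
Proof. by rewrite /ip adj_mul adjK mulmxA mxtrace_mulC mulmxA. Qed.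

Lemma ip_adj m n (A B : 'M[C]_(m, n)) : ip (adj A) (adj B) = ip A B.
Proof. by rewrite /ip adjK mxtrace_mulC -/(ip B A) ipC. Qed.

(** Pythagoras: the squared norm of [A - A P] is the difference of the two sides. *)
Lemma ip_proj_le m n (A : 'M[C]_(m, n)) (P : 'M[C]_n) :
  P = adj P -> P *m P = P -> ip (A *m P) (A *m P) <= ip A A.
Proof.
move=> hP PP.
have E : ip (A *m P) (A *m P) = ip A (A *m P).
  by rewrite ip_mulr -hP -mulmxA PP ipC.
have := ip_ge0 (A - A *m P); rewrite ip_sqB E.
lra.
Qed.

(* [T] is the adjoint of the partial isometry in the polar decomposition of [M]. *)
Lemma trnorm_polar m (M : 'M[C]_m) :
  exists T : 'M[C]_m, [/\ trnorm M = complex.Re (\tr (T *m M)),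
    (T *m adj T) *m (T *m adj T) = T *m adj T & T *m adj T *m T = T].
Proof.
(* Since [0^-1 = 0] and [Num.sqrt] vanishes on nonpositive reals, [r] inverts the square root on the
   support only. With [T = r(adj M M) adj M], the product [T adj T] is the support projection of
   [adj M M]. *)
pose r (x : R) := (Num.sqrt x)^-1.
have hM : adj M *m M = adj (adj M *m M) by rewrite adj_mul adjK.
have [Ud HUd E] := fun_mxP Num.sqrt hM.
have rr x : r x * x * r x = (if 0 < x then 1 else 0).
  rewrite /r; case: ifPn => [x0|]; last first.
    by rewrite -leNgt => x0; rewrite ler0_sqrtr // invr0 !mul0r.
  rewrite -{2}(sqr_sqrtr (ltW x0)).
  by have : Num.sqrt x != 0 by [rewrite sqrtr_eq0 -ltNge|]; move=> ?; field.
have [S ES] : {S | S = spectral_fun r Ud} by exists (spectral_fun r Ud).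
have adjS : adj S = S by rewrite ES spectral_fun_adj.
have TT : S *m adj M *m adj (S *m adj M) = spectral_fun (fun x => if 0 < x then 1 else 0) Ud.
  rewrite adj_mul adjK adjS !mulmxA -[X in X *m _]mulmxA ES.
  rewrite -{1}(spectral_fun_id HUd) !(spectral_funM HUd).
  by apply: eq_spectral_fun => i; exact: rr.
exists (S *m adj M); split.
- rewrite /trnorm E -mulmxA ES -(spectral_fun_id HUd) (spectral_funM HUd).
  congr (complex.Re (\tr _)); apply: eq_spectral_fun => i; rewrite /r.
  set x := Ud.2 i; have [x0|x0] := ltP 0 x; last by rewrite ler0_sqrtr // invr0 mul0r.
  rewrite -{3}(sqr_sqrtr (ltW x0)).
  by have : Num.sqrt x != 0 by [rewrite sqrtr_eq0 -ltNge|]; move=> ?; field.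
- rewrite TT (spectral_funM HUd); apply: eq_spectral_fun => i.
  by case: ifP; rewrite ?mulr1 ?mulr0.
- rewrite TT mulmxA ES (spectral_funM HUd); congr (_ *m _); apply: eq_spectral_fun => i.
  rewrite /r; case: ltP => x0; first by rewrite mul1r.
  by rewrite ler0_sqrtr // invr0 mul0r.
Qed.

(** Cauchy-Schwarz twice. With [w = h^2] and [T] from the polar decomposition, the trace norm is the
    product of [adj (h T h)] and [N], and the squared norm of [h T h] is the product of [w T] and
    [T w]. Multiplication by a partial isometry does not increase the norm of [w]. *)
Lemma trnorm_sandwich_le m (M h N : 'M[C]_m) : h = adj h -> M = h *m N *m h ->
  trnorm M <= Num.sqrt (ip (h *m h) (h *m h) * ip N N).
Proof.
move=> hh EM; have [T [-> TT1 TT2]] := trnorm_polar M.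
set w := h *m h.
have hw : w = adj w by rewrite adj_mul -hh.
have E : complex.Re (\tr (T *m M)) = ip (adj (h *m T *m h)) N.
  by rewrite /ip adjK EM -!mulmxA mxtrace_mulC !mulmxA mxtrace_mulC !mulmxA mxtrace_mulC !mulmxA.
have wT : ip (w *m T) (w *m T) <= ip w w.
  rewrite ip_mulr -mulmxA ipC; have := @ip_proj_le _ _ w (T *m adj T).
  rewrite adj_mul adjK => /(_ erefl TT1).
  by rewrite ip_mulr adj_mul adjK -mulmxA TT1 ipC.
(* The adjoint of [T w] is [w adj T], whose norm is governed by the other projection, [adj T T]. *)
have Tw : ip (T *m w) (T *m w) <= ip w w.
  rewrite -ip_adj adj_mul -hw ip_mulr adjK -mulmxA ipC.
  have QQ : adj T *m T *m (adj T *m T) = adj T *m T.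
    by rewrite -mulmxA; congr (_ *m _); rewrite mulmxA.
  have := @ip_proj_le _ _ w (adj T *m T).
  rewrite adj_mul adjK => /(_ erefl QQ).
  by rewrite ip_mulr adj_mul adjK -mulmxA QQ ipC.
have S : ip (h *m T *m h) (h *m T *m h) <= ip w w.
  have -> : ip (h *m T *m h) (h *m T *m h) = ip (w *m T) (T *m w).
    by rewrite [RHS]ip_mulr -hw [LHS]ip_mulr [LHS]ip_mull -hh /w !mulmxA.
  (* A negative product is trivially bounded; otherwise squares can be compared. *)
  have [t0|t0] := leP 0 (ip (w *m T) (T *m w)); last exact: le_trans (ltW t0) (ip_ge0 _).
  rewrite -(ler_pXn2r (ltn0Sn 1)) ?nnegrE ?ip_ge0 //.
  apply: le_trans (ip_CauchySchwarz _ _) _.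
  by rewrite expr2 ler_pM ?ip_ge0.
rewrite E; apply: le_trans (ler_norm _) _; rewrite -sqrtr_sqr ler_sqrt; last first.
  by rewrite mulr_ge0 ?ip_ge0.
apply: le_trans (ip_CauchySchwarz _ _) _.
by rewrite ip_adj ler_wpM2r ?ip_ge0.
Qed.
End Adjoint.

(** * Two-universality of the field hash *)

Section BitStrings.
Implicit Types (a b u v w : seq bool) (c d r s p : {poly 'F_2}).

Lemma size_xorb_seq a b : size a = size b -> size (xorb_seq a b) = size b.
Proof. by move=> ab; rewrite size_map size_zip ab minnn. Qed.

Lemma nth_xorb_seq a b i : size a = size b ->
  nth false (xorb_seq a b) i = nth false a i (+) nth false b i.
Proof.
elim: a b i => [|x a IH] [|y b] //= i; first by rewrite nth_nil.
by move=> [ab]; case: i => //= i; rewrite IH.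
Qed.

Lemma xorb_seqC a b : xorb_seq a b = xorb_seq b a.
Proof. by elim: a b => [|x a IH] [|y b] //=; rewrite /xorb_seq /= addbC -/(xorb_seq a b) IH. Qed.

Lemma xorb_seqA a b w : xorb_seq a (xorb_seq b w) = xorb_seq (xorb_seq a b) w.
Proof.
elim: a b w => [|x a IH] [|y b] [|z w] //=.
by have := IH b w; rewrite /xorb_seq /= addbA => ->.
Qed.

Lemma xorb_seqK a b : size a = size b -> xorb_seq a (xorb_seq a b) = b.
Proof. by elim: a b => [|x a IH] [|y b] //= [ab]; rewrite /xorb_seq /= addKb [map _ _]IH. Qed.

(** XOR with a fixed string is an involution, hence permutes the strings of its length. *)
Lemma sum_xorb (V : nmodType) m a (G : seq bool -> V) : size a = m ->
  \sum_(v : m.-tuple bool) G (xorb_seq a v) = \sum_(v : m.-tuple bool) G v.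
Proof.
move=> am.
have sz (v : m.-tuple bool) : size (xorb_seq a v) == m.
  by rewrite size_xorb_seq size_tuple.
have inj : injective (fun v : m.-tuple bool => Tuple (sz v)).
  move=> v v' /(congr1 val) /= /(congr1 (xorb_seq a)).
  by rewrite !xorb_seqK ?size_tuple // => /val_inj.
by rewrite [RHS](reindex_inj inj).
Qed.

Lemma sum_tuple_cat (V : nmodType) m n (G : seq bool -> V) :
  \sum_(t : (m + n).-tuple bool) G t =
  \sum_(x : m.-tuple bool) \sum_(y : n.-tuple bool) G (x ++ y).
Proof.
pose f (xy : m.-tuple bool * n.-tuple bool) := [tuple of xy.1 ++ xy.2].
have szt (t : (m + n).-tuple bool) : size (take m t) == m.
  by rewrite size_takel // size_tuple leq_addr.
have szd (t : (m + n).-tuple bool) : size (drop m t) == n.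
  by rewrite size_drop size_tuple addKn.
pose g t := (Tuple (szt t), Tuple (szd t)).
rewrite pair_big (reindex f) //=.
exists g => [[x y]|t] _; last by apply: val_inj; rewrite /= cat_take_drop.
congr pair; apply: val_inj => /=.
  by rewrite -[X in take X]/m -{1}(size_tuple x) take_size_cat.
by rewrite -{1}(size_tuple x) drop_size_cat.
Qed.

Lemma sum_tuple_cons (V : nmodType) n (G : seq bool -> V) :
  \sum_(t : n.+1.-tuple bool) G t = \sum_b \sum_(t : n.-tuple bool) G (b :: t).
Proof.
rewrite (sum_tuple_cat 1 n) (reindex (fun b : bool => [tuple b])) //.
by exists (fun t : 1.-tuple bool => thead t) => [b|t] _ //; apply: val_inj; case: t => [[|b []]].
Qed.

Lemma F2_eq1D (x y : 'F_2) : (x + y == 1) = (x == 1) (+) (y == 1).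
Proof. by case: x y => [[|[|]] // ?] [[|[|]] // ?]. Qed.

Lemma F2_bool (x : 'F_2) : (x == 1)%:R = x.
Proof. by case: x => [[|[|]] // ?]; apply/val_inj. Qed.

Lemma coef_bpoly w i :
  (bpoly w)`_i = (if (i < size w)%N then nth false w (size w - i.+1) else false)%:R.
Proof.
rewrite /bpoly coef_sum; case: ifPn => [iw|].
  have jw : (size w - i.+1 < size w)%N by lia.
  rewrite (bigD1 (Ordinal jw)) //= coefZ coefXn subnSK // subKn ?eqxx ?mulr1; last by lia.
  rewrite big1 ?addr0 // => j jn; rewrite coefZ coefXn.
  case: eqP => [E|_]; last by rewrite mulr0.
  case/eqP: jn; apply/val_inj => /=; have := ltn_ord j; lia.
rewrite -leqNgt => wi; rewrite big1 // => j _; rewrite coefZ coefXn.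
case: eqP => [E|_]; last by rewrite mulr0.
have := ltn_ord j; lia.
Qed.

Lemma size_bpoly w : (size (bpoly w) <= size w)%N.
Proof. by apply/leq_sizeP => i wi; rewrite coef_bpoly ltnNge wi. Qed.

Lemma size_pbits m r : size (pbits m r) = m.
Proof. by rewrite size_map size_iota. Qed.

Lemma nth_pbits m r i : (i < m)%N -> nth false (pbits m r) i = (r`_(m - i.+1) == 1).
Proof. by move=> im; rewrite (nth_map 0%N) ?size_iota // nth_iota. Qed.

Lemma pbitsK m r : (size r <= m)%N -> bpoly (pbits m r) = r.
Proof.
move=> rm; apply/polyP => i; rewrite coef_bpoly size_pbits.
case: ltnP => im; last by rewrite nth_default // (leq_trans rm).
by rewrite nth_pbits ?F2_bool; [congr (_ `_ _)|]; lia.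
Qed.

Lemma bpolyK w : pbits (size w) (bpoly w) = w.
Proof.
apply: (@eq_from_nth _ false); rewrite size_pbits // => i iw.
rewrite nth_pbits // coef_bpoly.
have -> : (size w - i.+1 < size w)%N by lia.
have -> : (size w - (size w - i.+1).+1 = i)%N by lia.
by case: (nth _ _ _).
Qed.

Lemma bpoly_xorb a b : size a = size b -> bpoly (xorb_seq a b) = bpoly a + bpoly b.
Proof.
move=> ab; apply/polyP => i; rewrite coefD !coef_bpoly size_xorb_seq // ab.
case: ifP => _; last by rewrite addr0.
rewrite nth_xorb_seq //.
by case: (nth _ a _); case: (nth _ b _); apply/val_inj.
Qed.

Lemma pbitsD m r s : pbits m (r + s) = xorb_seq (pbits m r) (pbits m s).
Proof.
apply: (@eq_from_nth _ false); rewrite ?size_xorb_seq ?size_pbits // => i im.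
by rewrite nth_xorb_seq ?size_pbits // !nth_pbits // coefD F2_eq1D.
Qed.

Lemma size_lsb m r : size (lsb m r) = m.
Proof. exact: size_pbits. Qed.

Lemma lsbD m r s : lsb m (r + s) = xorb_seq (lsb m r) (lsb m s).
Proof. by rewrite /lsb modpD pbitsD. Qed.

(** * The hash given by multiplication in the finite field *)

Section Hash.
Variables (p : {poly 'F_2}) (lam m : nat).
Hypotheses (p_irr : irreducible_poly p) (p_size : size p = lam.+1) (m_lam : (m <= lam)%N).

(** For [c = bpoly k] this is the mask in [bkuv] before [v] is added. The key is a polynomial so
    that keys can be summed. *)
Definition hash c u := lsb m ((bpoly u * c) %% p).

Lemma size_hash c u : size (hash c u) = m.
Proof. exact: size_lsb. Qed.

Lemma hash_xorb c u v : size u = size v ->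
  hash c (xorb_seq u v) = xorb_seq (hash c u) (hash c v).
Proof. by move=> uv; rewrite /hash bpoly_xorb // mulrDl modpD lsbD. Qed.

Lemma hashD c d u : hash (c + d) u = xorb_seq (hash c u) (hash d u).
Proof. by rewrite /hash mulrDr modpD lsbD. Qed.

(** [c] is invertible modulo the irreducible [p], so [u] can be [w] times that inverse. The product
    reduces to [bpoly w], of size at most [m], which neither reduction changes. *)
Lemma hash_surj c w : c != 0 -> (size c <= lam)%N -> size w = m ->
  exists2 u, size u = lam & hash c u = w.
Proof.
move=> c0 clam wm.
(* A nontrivial common divisor would be associate to [p], of size [lam.+1], yet divide [c], of size
   at most [lam]. *)
have : coprimep p c.
  rewrite coprimep_def; have [//|d1] := eqVneq (size (gcdp p c)) 1%N.
  have := dvdp_leq c0 (dvdp_gcdr p c).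
  have /eqp_size -> := p_irr.2 _ d1 (dvdp_gcdl p c).
  by rewrite p_size ltnNge clam.
case/Bezout_eq1_coprimepP => -[x y] /= xy.
have p0 : p != 0 by rewrite -size_poly_gt0 p_size.
set r := (bpoly w * y) %% p.
have r_lam : (size r <= lam)%N by rewrite -ltnS -p_size ltn_modp.
have w_lam : (size (bpoly w) <= m)%N by rewrite -wm size_bpoly.
exists (pbits lam r); first exact: size_pbits.
rewrite /hash pbitsK // /r [_ * c]mulrC modp_mul mulrC -mulrA.
have -> : y * c = - x * p + 1 by rewrite -xy mulNr addKr.
rewrite mulrDr mulr1 mulrA modpD modp_mull add0r modp_small; last first.
  by rewrite p_size ltnS (leq_trans w_lam).
by rewrite /lsb modp_small ?size_polyXn ?ltnS // -{1}wm bpolyK.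
Qed.

(* By surjectivity, every translation of the hash value is induced by a translation of [u]. *)
Lemma sum_hash (V : nmodType) c (H : seq bool -> V) : c != 0 -> (size c <= lam)%N ->
  (\sum_(u : lam.-tuple bool) H (hash c u)) *+ 2 ^ m =
  (\sum_(w : m.-tuple bool) H w) *+ 2 ^ lam.
Proof.
move=> c0 clam.
have shift (w : m.-tuple bool) : \sum_(u : lam.-tuple bool) H (hash c u) =
    \sum_(u : lam.-tuple bool) H (xorb_seq (hash c u) w).
  have [s su sw] := hash_surj c0 clam (size_tuple w).
  rewrite -(sum_xorb (fun u => H (hash c u)) su).
  by apply: eq_bigr => u _; rewrite hash_xorb ?size_tuple // sw xorb_seqC.
(* Summed over all [w], the shifted argument is uniform whatever the hash value. *)
transitivity (\sum_(w : m.-tuple bool) \sum_(u : lam.-tuple bool) H (xorb_seq (hash c u) w)).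
  rewrite -(eq_bigr _ (fun (w : m.-tuple bool) _ => shift w)) sumr_const card_tuple card_bool.
  by [].
rewrite exchange_big /= -card_bool -card_tuple -sumr_const.
by apply: eq_bigr => u _; rewrite sum_xorb ?size_hash.
Qed.

(* Translating [v] by the first hash turns the pair into [v] and [v] masked by the hash
   with key [k + k'], a nonzero field element. *)
Lemma sum_hash_pair (V : nmodType) (k k' : seq bool) (G : seq bool -> seq bool -> V) :
  size k = size k' -> (size k <= lam)%N -> k != k' ->
  (\sum_(u : lam.-tuple bool) \sum_(v : m.-tuple bool)
     G (xorb_seq (hash (bpoly k) u) v) (xorb_seq (hash (bpoly k') u) v)) *+ 2 ^ m =
  (\sum_(x : m.-tuple bool) \sum_(y : m.-tuple bool) G x y) *+ 2 ^ lam.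
Proof.
move=> sk klam kk'.
(* [bpoly] is injective on strings of equal length, and in characteristic 2 a vanishing sum means
   equality. *)
have c0 : bpoly k' + bpoly k != 0.
  apply: contra kk' => /eqP E; apply/eqP.
  rewrite -(bpolyK k) -[RHS]bpolyK sk; congr pbits; apply/polyP => i.
  have := congr1 (fun q : {poly 'F_2} => q`_i) E; rewrite /= coefD coef0.
  by case: (_`_i) (_`_i) => [[|[|]] // ?] [[|[|]] // ?] _; apply/val_inj.
have clam : (size (bpoly k' + bpoly k)%R <= lam)%N.
  apply: leq_trans (size_polyD _ _) _; rewrite geq_max.
  by rewrite !(leq_trans (size_bpoly _)) // -sk.
have E (u : lam.-tuple bool) : \sum_(v : m.-tuple bool)
     G (xorb_seq (hash (bpoly k) u) v) (xorb_seq (hash (bpoly k') u) v) =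
   \sum_(v : m.-tuple bool) G v (xorb_seq (hash (bpoly k' + bpoly k) u) v).
  rewrite -(sum_xorb (fun v => G v (xorb_seq (hash (bpoly k' + bpoly k) u) v))
    (size_hash (bpoly k) u)).
  apply: eq_bigr => v _; congr G.
  by rewrite hashD -xorb_seqA xorb_seqK ?size_hash ?size_tuple.
rewrite (eq_bigr _ (fun (u : lam.-tuple bool) _ => E u)) exchange_big /= -!sumrMnl.
apply: eq_bigr => v _.
rewrite (sum_hash (fun w => G v (xorb_seq w v)) c0 clam); congr (_ *+ _).
rewrite -(sum_xorb (G v) (size_tuple v)).
by apply: eq_bigr => w _; rewrite xorb_seqC.
Qed.
End Hash.
End BitStrings.

(** * The Pauli twirl *)

Section Pauli.
Local Open Scope complex_scope.
Variable R : realType.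
Local Notation C := R[i].

Lemma pXZE s q i j :
  pXZ R s q i j = (s == (i != j))%:R * (-1) ^+ (q && (j != 0)).
Proof.
case: i j => [[|[|]] // hi] [[|[|]] // hj]; case: s; case: q;
  rewrite /pXZ ?mul1mx ?mulmx1 !mxE ?big_ord_recl ?big_ord0 ?mxE /=;
  by rewrite ?mxE ?mulr0 ?mul0r ?mul1r ?mulr1 ?addr0 ?add0r ?expr0 ?expr1 ?mulr1n ?mulr0n.
Qed.

Lemma conjc_pXZ s q i j : conjc (pXZ R s q i j) = pXZ R s q i j.
Proof. by rewrite pXZE rmorphM rmorph_nat rmorphXn rmorphN1. Qed.

(** Completeness relation: the four products form an orthogonal basis of the 2 by 2 matrices, each
    of squared norm 2. *)
Lemma sum_pXZ a a' b b' :
  \sum_s \sum_q pXZ R s q a a' * conjc (pXZ R s q b b') =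
  2%:R * ((a == b) && (a' == b'))%:R.
Proof.
rewrite !big_bool !conjc_pXZ !pXZE.
case: a a' b b' => [[|[|]] // ?] [[|[|]] // ?] [[|[|]] // ?] [[|[|]] // ?] /=; ring.
Qed.

(** Completeness in dimension [2^n], by splitting off the first qubit: entries of a tensor product
    factor, and so do the sums over bits. *)
Lemma sum_paulis n (a a' b b' : 'I_(2 ^ n)) :
  \sum_(s : n.-tuple bool) \sum_(q : n.-tuple bool)
    paulis R (fun i => nth false s i) (fun i => nth false q i) a a' *
    conjc (paulis R (fun i => nth false s i) (fun i => nth false q i) b b') =
  (2 ^ n)%:R * ((a == b) && (a' == b'))%:R.
Proof.
elim: n a a' b b' => [|n IH] a a' b b'.
  rewrite (big_pred1 [tuple]) => [|t]; last by rewrite [t]tuple0.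
  rewrite (big_pred1 [tuple]) => [|t]; last by rewrite [t]tuple0.
  have o (x y : 'I_(2 ^ 0)) : x == y by move: x y; rewrite expn0 => x y; rewrite !ord1.
  rewrite /= !mxE.
  by rewrite !o rmorph_nat !mulr1.
rewrite (sum_tuple_cons n (fun s => \sum_(q : n.+1.-tuple bool)
  paulis R (fun i : 'I_n.+1 => nth false s i) (fun i => nth false q i) a a' *
  conjc (paulis R (fun i : 'I_n.+1 => nth false s i) (fun i => nth false q i) b b'))).
have cK (x y : 'I_(2 ^ n.+1)) :
    (x == y) = (cast_ord (expnS 2 n) x == cast_ord (expnS 2 n) y).
  by rewrite (inj_eq (@cast_ord_inj _ _ _)).
rewrite (cK a b) (cK a' b').
transitivity (\sum_s0 \sum_(s : n.-tuple bool) \sum_q0 \sum_(q : n.-tuple bool)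
  (pXZ R s0 q0 *t paulis R (fun i => nth false s i) (fun i => nth false q i))
    (cast_ord (expnS 2 n) a) (cast_ord (expnS 2 n) a') *
  conjc ((pXZ R s0 q0 *t paulis R (fun i => nth false s i) (fun i => nth false q i))
    (cast_ord (expnS 2 n) b) (cast_ord (expnS 2 n) b'))).
  apply: eq_bigr => s0 _; apply: eq_bigr => s _.
  rewrite (sum_tuple_cons n (fun q =>
    paulis R (fun i : 'I_n.+1 => nth false (s0 :: s) i) (fun i => nth false q i) a a' *
    conjc (paulis R (fun i : 'I_n.+1 => nth false (s0 :: s) i) (fun i => nth false q i) b b'))).
  apply: eq_bigr => q0 _; apply: eq_bigr => q _.
  by rewrite /= !castmxE !esymK.
case: (mxtens_indexP (cast_ord _ a)) => a0 a1; case: (mxtens_indexP (cast_ord _ a')) => a0' a1'.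
case: (mxtens_indexP (cast_ord _ b)) => b0 b1; case: (mxtens_indexP (cast_ord _ b')) => b0' b1'.
rewrite !(inj_eq (can_inj (@mxtens_indexK _ _))) !xpair_eqE.
transitivity ((\sum_s0 \sum_q0 pXZ R s0 q0 a0 a0' * conjc (pXZ R s0 q0 b0 b0')) *
  (\sum_(s : n.-tuple bool) \sum_(q : n.-tuple bool)
    paulis R (fun i => nth false s i) (fun i => nth false q i) a1 a1' *
    conjc (paulis R (fun i => nth false s i) (fun i => nth false q i) b1 b1'))).
  rewrite mulr_suml; apply: eq_bigr => s0 _.
  rewrite exchange_big mulr_suml; apply: eq_bigr => q0 _.
  rewrite mulr_sumr; apply: eq_bigr => s _; rewrite mulr_sumr; apply: eq_bigr => q _.
  by rewrite !tensmxE rmorphM mulrACA.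
rewrite sum_pXZ IH mulrACA -[2%:R * _]natrM -expnS; congr (_ * _); rewrite -natrM mulnb.
by congr (nat_of_bool _)%:R; case: (a0 == b0); case: (a0' == b0'); rewrite ?andbF.
Qed.

Lemma sum_mxtens_index (V : nmodType) m n (F : 'I_(m * n) -> V) :
  \sum_k F k = \sum_i \sum_j F (mxtens_index (i, j)).
Proof.
rewrite pair_big (reindex (@mxtens_index _ _)); last first.
  by exists (@mxtens_unindex _ _) => k _; rewrite ?mxtens_indexK ?mxtens_unindexK.
by apply: eq_bigr => -[].
Qed.

Lemma tensmx11 m n : (1%:M : 'M[C]_m) *t (1%:M : 'M[C]_n) = 1%:M.
Proof.
apply/matrixP => x y; case: (mxtens_indexP x) => a i; case: (mxtens_indexP y) => b j.
rewrite tensmxE !mxE (inj_eq (can_inj (@mxtens_indexK _ _))) xpair_eqE.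
by case: (a == b); rewrite ?mul1r ?mul0r.
Qed.

Lemma unitary_castmx m n (e : m = n) (A : 'M[C]_m) :
  adj A *m A = 1%:M -> adj (castmx (e, e) A) *m castmx (e, e) A = 1%:M.
Proof. by case: n / e. Qed.

Lemma pXZ_unitary s q : adj (pXZ R s q) *m pXZ R s q = 1%:M.
Proof.
apply/matrixP => i j; rewrite !mxE big_ord_recl big_ord1 !adjE !conjc_pXZ !pXZE.
by case: i j => [[|[|]] // ?] [[|[|]] // ?]; case: s; case: q => /=; ring.
Qed.

Lemma paulis_unitary n (s q : 'I_n -> bool) : adj (paulis R s q) *m paulis R s q = 1%:M.
Proof.
elim: n s q => [|n IH] s q /=; first by rewrite adj_id mulmx1.
apply: unitary_castmx; rewrite adj_tens tensmx_mul IH pXZ_unitary tensmx11.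
by [].
Qed.

(** * Averaging over all Pauli operators on A *)

Section Twirl.
Variables (n dE : nat).
Implicit Types (beta : seq bool) (M A : 'M[C]_(2 ^ n * dE)).

Definition Ubeta_tens1 beta : 'M[C]_(2 ^ n * dE) := Ubeta R n beta *t (1%:M : 'M[C]_dE).

Lemma Ubeta_tens1_unitary beta : adj (Ubeta_tens1 beta) *m Ubeta_tens1 beta = 1%:M.
Proof.
rewrite adj_tens adj_id tensmx_mul paulis_unitary mulmx1.
exact: tensmx11.
Qed.

Lemma FbetaE beta M : Fbeta beta M = Ubeta_tens1 beta *m M *m adj (Ubeta_tens1 beta).
Proof. by []. Qed.

Lemma Ubeta_tens1_comm beta (sigma : 'M[C]_dE) :
  Ubeta_tens1 beta *m (1%:M *t sigma) = (1%:M *t sigma) *m Ubeta_tens1 beta.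
Proof. by rewrite !tensmx_mul !mul1mx !mulmx1. Qed.

(** Completeness keeps only the terms with [a = b] and [a' = b']: the first condition gives the
    identity on A, the second the partial trace. *)
Lemma sum_Fbeta M :
  \sum_(s : n.-tuple bool) \sum_(q : n.-tuple bool) Fbeta (s ++ q) M =
  (2 ^ n)%:R *: ((1%:M : 'M[C]_(2 ^ n)) *t ptrA M).
Proof.
apply/matrixP => x y.
case: (mxtens_indexP x) => a i; case: (mxtens_indexP y) => b j.
rewrite mxE tensmxE [1%:M a b]mxE [ptrA M i j]mxE.
pose P (s q : n.-tuple bool) :=
  paulis R (fun i : 'I_n => nth false s i) (fun i : 'I_n => nth false q i).
have UE (s q : n.-tuple bool) : Ubeta R n (s ++ q) = P s q.
  rewrite /Ubeta /P; congr paulis; apply/funext => k.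
    by rewrite nth_cat size_tuple ltn_ord.
  by rewrite nth_cat size_tuple ltnNge leq_addr /= addKn.
(* The operator acts as the identity on E, so the intermediate E-indices collapse to [i] and [j]. *)
have FE (s q : n.-tuple bool) : Fbeta (s ++ q) M (mxtens_index (a, i)) (mxtens_index (b, j)) =
   \sum_a' \sum_b' P s q a a' * conjc (P s q b b') *
     M (mxtens_index (a', i)) (mxtens_index (b', j)).
  rewrite FbetaE mxE sum_mxtens_index exchange_big /= (bigD1 j) //=.
  rewrite [X in _ + X]big1 ?addr0; last first.
    move=> j' jj'; apply: big1 => b' _.
    by rewrite adjE tensmxE [1%:M _ _]mxE eq_sym (negPf jj') mulr0 conjc0 mulr0.
  rewrite exchange_big /=; apply: eq_bigr => b' _.
  rewrite adjE tensmxE [1%:M _ _]mxE eqxx mulr1 UE mxE sum_mxtens_index mulr_suml.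
  apply: eq_bigr => a' _; rewrite (bigD1 i) //= [X in _ + X]big1 ?addr0; last first.
    by move=> i' ii'; rewrite tensmxE [1%:M _ _]mxE eq_sym (negPf ii') mulr0 mul0r.
  by rewrite tensmxE [1%:M _ _]mxE eqxx mulr1 UE mulrAC.
rewrite summxE (eq_bigr _ (fun s _ => summxE _ _ _ _ _)).
transitivity (\sum_a' \sum_b' (\sum_s \sum_q P s q a a' * conjc (P s q b b')) *
  M (mxtens_index (a', i)) (mxtens_index (b', j))).
  transitivity (\sum_s \sum_q \sum_a' \sum_b' P s q a a' * conjc (P s q b b') *
    M (mxtens_index (a', i)) (mxtens_index (b', j))).
    by apply: eq_bigr => s _; apply: eq_bigr => q _; rewrite FE.
  rewrite (eq_bigr _ (fun s _ => exchange_big _ _ _ _ _ _)) exchange_big /=.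
  apply: eq_bigr => a' _.
  rewrite (eq_bigr _ (fun s _ => exchange_big _ _ _ _ _ _)) exchange_big /=.
  apply: eq_bigr => b' _.
  by rewrite mulr_suml; apply: eq_bigr => s _; rewrite mulr_suml.
rewrite mulr_sumr mulr_sumr; apply: eq_bigr => a' _.
rewrite (bigD1 a') //= sum_paulis eqxx andbT [X in _ + X]big1 ?addr0 ?mulrA // => b' bb'.
by rewrite sum_paulis [a' == b']eq_sym (negPf bb') andbF mulr0 mul0r.
Qed.
End Twirl.
End Pauli.

(** * Second moment of the deviation *)

Section Variance.
Local Open Scope complex_scope.
Variables (R : realType) (N l m lam : nat) (p : {poly 'F_2}) (c : R).
Local Notation C := R[i].
Variable G : seq bool -> seq bool -> 'M[C]_N.
Hypotheses (p_irr : irreducible_poly p) (p_size : size p = lam.+1).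
Hypotheses (m_lam : (m <= lam)%N) (l_lam : (l <= lam)%N).
Hypothesis G_norm : forall k q, ip (G k q) (G k q) = c.

Let S u v := \sum_(k : l.-tuple bool) G k (xorb_seq (hash p m (bpoly k) u) v).
Let T := \sum_(k : l.-tuple bool) \sum_(q : m.-tuple bool) G k q.

(** The subtracted term is the mean of the first one over [u] and [v], so the second moment below is
    a variance. *)
Definition deviation u v : 'M[C]_N :=
  ((2 ^ l)%:R^-1)%:C *: S u v - ((2 ^ (l + m))%:R^-1)%:C *: T.

(** The sum over [v] alone suffices: for each [u] it makes every mask uniform. *)
Let sum_ipST : \sum_(u : lam.-tuple bool) \sum_(v : m.-tuple bool) ip (S u v) T =
  (2 ^ lam)%:R * ip T T.
Proof.
rewrite mulr_natl -card_bool -card_tuple -sumr_const; apply: eq_bigr => u _.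
rewrite -ip_suml exchange_big /=; congr (ip _ _).
by apply: eq_bigr => k _; rewrite sum_xorb // size_hash.
Qed.

(** Expanding the square gives pairs of keys. Distinct keys have independent masks and yield
    products of the full sums [A_ k]; equal keys contribute the constant [c]. Adding the nonnegative
    [ip (A_ k) (A_ k)] completes the former to [ip T T]. *)
Let sum_ipSS_le : (2 ^ m)%:R *
    (\sum_(u : lam.-tuple bool) \sum_(v : m.-tuple bool) ip (S u v) (S u v)) <=
  (2 ^ lam)%:R * ip T T + (2 ^ l)%:R * (2 ^ lam)%:R * (2 ^ m)%:R ^+ 2 * c.
Proof.
pose H (k k' : l.-tuple bool) u v := ip (G k (xorb_seq (hash p m (bpoly k) u) v))
  (G k' (xorb_seq (hash p m (bpoly k') u) v)).
pose A_ (k : l.-tuple bool) := \sum_(q : m.-tuple bool) G k q.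
have -> : \sum_(u : lam.-tuple bool) \sum_(v : m.-tuple bool) ip (S u v) (S u v) =
    \sum_k \sum_k' \sum_(u : lam.-tuple bool) \sum_(v : m.-tuple bool) H k k' u v.
  transitivity (\sum_(u : lam.-tuple bool) \sum_(v : m.-tuple bool) \sum_k \sum_k' H k k' u v).
    apply: eq_bigr => u _; apply: eq_bigr => v _; rewrite ip_suml.
    by apply: eq_bigr => k _; rewrite ip_sumr.
  rewrite pair_big exchange_big /=; apply: eq_bigr => k _.
  rewrite exchange_big /=; apply: eq_bigr => k' _.
  by rewrite pair_big.
have bound k k' : (2 ^ m)%:R * (\sum_(u : lam.-tuple bool) \sum_(v : m.-tuple bool) H k k' u v)
    <= (2 ^ lam)%:R * ip (A_ k) (A_ k') + (k == k')%:R * ((2 ^ lam)%:R * (2 ^ m)%:R ^+ 2 * c).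
  have [<-|kk'] := eqVneq k k'.
    rewrite (eq_bigr (fun=> \sum_(v : m.-tuple bool) c)) => [|u _]; last first.
      by apply: eq_bigr => v _; rewrite /H G_norm.
    rewrite !sumr_const !card_tuple !card_bool -[c *+ _ *+ _]mulr_natl -[c *+ _]mulr_natl mul1r.
    apply: (@le_trans _ _ ((2 ^ lam)%:R * (2 ^ m)%:R ^+ 2 * c)).
      by rewrite le_eqVlt; apply/orP; left; apply/eqP; ring.
    by rewrite lerDr mulr_ge0 ?ip_ge0 ?ler0n.
  rewrite mul0r addr0 !mulr_natl.
  rewrite (@sum_hash_pair p lam m p_irr p_size m_lam R k k' (fun x y => ip (G k x) (G k' y)));
    rewrite ?size_tuple //.
  rewrite le_eqVlt; apply/orP; left; apply/eqP; congr (_ *+ _); rewrite ip_suml.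
  by apply: eq_bigr => x _; rewrite ip_sumr.
rewrite mulr_sumr; under eq_bigr do rewrite mulr_sumr.
apply: le_trans (ler_sum _ (fun k _ => ler_sum _ (fun k' _ => bound k k'))) _.
under eq_bigr do rewrite big_split /= -mulr_sumr.
rewrite big_split /= -mulr_sumr; apply: lerD.
  rewrite le_eqVlt; apply/orP; left; apply/eqP; congr (_ * _); rewrite ip_suml.
  by apply: eq_bigr => k _; rewrite ip_sumr.
rewrite le_eqVlt; apply/orP; left; apply/eqP.
rewrite (eq_bigr (fun=> (2 ^ lam)%:R * (2 ^ m)%:R ^+ 2 * c)) => [|k _]; last first.
  by rewrite (bigD1 k) //= eqxx mul1r big1 ?addr0 // => k' /negPf kk'; rewrite eq_sym kk' mul0r.
by rewrite sumr_const card_tuple card_bool -[_ *+ 2 ^ l]mulr_natl !mulrA.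
Qed.

Lemma hash_variance :
  \sum_(u : lam.-tuple bool) \sum_(v : m.-tuple bool) ip (deviation u v) (deviation u v) <=
  (2 ^ lam * 2 ^ m)%:R * ((2 ^ l)%:R^-1 * c).
Proof.
have [K0 M0] : (2 ^ l)%:R != 0 :> R /\ (2 ^ m)%:R != 0 :> R.
  by split; rewrite pnatr_eq0 expn_eq0.
have Mp : 0 < (2 ^ m)%:R :> R by rewrite ltr0n expn_gt0.
have Kp : 0 < (2 ^ l)%:R :> R by rewrite ltr0n expn_gt0.
pose a : R := (2 ^ l)%:R^-1; pose b : R := (2 ^ (l + m))%:R^-1.
have -> : \sum_(u : lam.-tuple bool) \sum_(v : m.-tuple bool) ip (deviation u v) (deviation u v) =
   a ^+ 2 * (\sum_(u : lam.-tuple bool) \sum_(v : m.-tuple bool) ip (S u v) (S u v))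
   - 2 * a * b * (\sum_(u : lam.-tuple bool) \sum_(v : m.-tuple bool) ip (S u v) T)
   + (2 ^ lam * 2 ^ m)%:R * b ^+ 2 * ip T T.
  transitivity (\sum_(u : lam.-tuple bool) \sum_(v : m.-tuple bool)
      (a ^+ 2 * ip (S u v) (S u v) - 2 * a * b * ip (S u v) T + b ^+ 2 * ip T T)).
    apply: eq_bigr => u _; apply: eq_bigr => v _.
    rewrite /deviation ip_sqB !ipZr ![ip (_ *: _) _]ipC !ipZr [ip T (S u v)]ipC -/a -/b.
    ring.
  rewrite !pair_big /= !big_split /= -mulr_sumr sumrN -mulr_sumr sumr_const.
  by rewrite card_prod !card_tuple !card_bool -[_ *+ (2 ^ lam * 2 ^ m)]mulr_natl mulrA.
rewrite sum_ipST; have := sum_ipSS_le.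
set SS := \sum_u _; set tt := ip T T => SSle.
have SSle' : SS <=
    ((2 ^ lam)%:R * tt + (2 ^ l)%:R * (2 ^ lam)%:R * (2 ^ m)%:R ^+ 2 * c) / (2 ^ m)%:R.
  by rewrite ler_pdivlMr // mulrC.
have a2 : 0 <= a ^+ 2 by rewrite sqr_ge0.
have := ler_wpM2l a2 SSle'.
have -> : b = a / (2 ^ m)%:R by rewrite /b expnD natrM invfM.
rewrite /a; set x := _ * SS => xle.
apply: (@le_trans _ _ ((2 ^ l)%:R^-1 ^+ 2 *
    (((2 ^ lam)%:R * tt + (2 ^ l)%:R * (2 ^ lam)%:R * (2 ^ m)%:R ^+ 2 * c) / (2 ^ m)%:R)
  - 2 * (2 ^ l)%:R^-1 * ((2 ^ l)%:R^-1 / (2 ^ m)%:R) * ((2 ^ lam)%:R * tt) +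
  (2 ^ lam * 2 ^ m)%:R * ((2 ^ l)%:R^-1 / (2 ^ m)%:R) ^+ 2 * tt)).
  by rewrite !lerD2r.
(* The [tt] terms have coefficients in ratio [1 : -2 : 1] and cancel; only the diagonal contribution
   survives. *)
rewrite le_eqVlt; apply/orP; left; apply/eqP; rewrite natrM; field.
by rewrite K0 M0.
Qed.
End Variance.

(** Jensen for the square root, from the nonnegative variance of the roots around their mean [t]. *)
Lemma mean_sqrt_le (R : realType) (I : finType) (f : I -> R) : (0 < #|I|)%N ->
  (forall i, 0 <= f i) ->
  #|I|%:R^-1 * \sum_i Num.sqrt (f i) <= Num.sqrt (#|I|%:R^-1 * \sum_i f i).
Proof.
move=> I0 f0; set n : R := #|I|%:R; have n0 : 0 < n by rewrite ltr0n.
set t := _ * \sum_i Num.sqrt _.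
have t0 : 0 <= t.
  by apply: mulr_ge0; [rewrite invr_ge0 ltW|apply: sumr_ge0 => i _; apply: sqrtr_ge0].
have : 0 <= \sum_i (Num.sqrt (f i) - t) ^+ 2 by apply: sumr_ge0 => i _; apply: sqr_ge0.
have -> : \sum_i (Num.sqrt (f i) - t) ^+ 2 = n * (n^-1 * (\sum_i f i) - t ^+ 2).
  under eq_bigr do rewrite sqrrB sqr_sqrtr //.
  rewrite big_split /= big_split /= sumr_const sumrN sumrMnl -mulr_suml.
  have -> : \sum_i Num.sqrt (f i) = n * t by rewrite mulrA divff ?mul1r ?gt_eqF.
  rewrite -[_ *+ #|_|]mulr_natl -/n; field; exact: lt0r_neq0.
rewrite pmulr_rge0 // subr_ge0 => /(fun h => ler_wsqrtr h).
by rewrite sqrtr_sqr ger0_norm.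
Qed.

(** * The bound for a fixed state on E *)

Section Smoothing.
Local Open Scope complex_scope.
Variable R : realType.
Local Notation C := R[i].

Lemma invnatC k : ((k%:R^-1 : R)%:C : C) = k%:R^-1.
Proof. by rewrite fmorphV rmorph_nat. Qed.

Lemma gram_ge0 m n (A : 'M[C]_(m, n)) (v : 'cV[C]_n) :
  0 <= (adj v *m (adj A *m A) *m v) 0 0.
Proof.
rewrite mulmxA -adj_mul -mulmxA mxE; apply: sumr_ge0 => i _.
by rewrite adjE mulrC mulcJ_ge0.
Qed.

(** The tensor product is the Gram matrix of [1 (x) sqrt sigma]. *)
Lemma tens1_psd dA dE (sigma : 'M[C]_dE) :
  psd sigma -> psd ((1%:M : 'M[C]_dA) *t sigma).
Proof.
move=> [hs ps]; split; first by rewrite adj_tens adj_id -hs.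
have [Ud HUd] := hermitian_spectral_decomp hs.
pose g := spectral_fun Num.sqrt Ud.
have gg : adj g *m g = sigma.
  rewrite /g spectral_fun_adj (spectral_funM HUd) -[RHS](spectral_fun_id HUd).
  by apply: eq_spectral_fun => i; rewrite -expr2 sqr_sqrtr // (spectral_ge0 HUd).
move=> v; have -> : (1%:M : 'M[C]_dA) *t sigma = adj (1%:M *t g) *m (1%:M *t g).
  by rewrite adj_tens adj_id tensmx_mul mul1mx gg.
exact: gram_ge0.
Qed.

Lemma tr_tens1 dA dE (sigma : 'M[C]_dE) :
  \tr ((1%:M : 'M[C]_dA) *t sigma) = dA%:R * \tr sigma.
Proof.
rewrite {1}/mxtrace sum_mxtens_index.
under eq_bigr do under eq_bigr do rewrite tensmxE [1%:M _ _]mxE eqxx mul1r.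
by rewrite sumr_const card_ord mulr_natl.
Qed.

Lemma inv_qrt_mul (x : R) : inv_qrt x * (x `^ 4%:R^-1) = (if 0 < x then 1 else 0).
Proof.
rewrite /inv_qrt; case: ifP => x0; last by rewrite mul0r.
rewrite -powRD; first by rewrite addNr powRr0.
by apply/implyP => _; rewrite gt_eqF.
Qed.

Lemma qrt_pow4 (x : R) : 0 <= x ->
  let y := x `^ 4%:R^-1 in y * y * (y * y) = x.
Proof.
move=> x0 y; have -> : y * y * (y * y) = y ^+ 4 by ring.
rewrite -powR_mulrn ?powR_ge0 // -powRrM mulVf ?pnatr_eq0 //.
by rewrite powRr1.
Qed.

(** The spectral function is the support projection [P] of [A]. Positivity gives [A (1 - P) = 0], so
    the columns of [1 - P] lie in the kernel of [A], hence in that of [B]. *)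
Lemma ker_sub_proj n (A B : 'M[C]_n) (Ud : 'M[C]_n * ('I_n -> R)) :
  psd A -> spectral_decomp A Ud -> ker_sub A B ->
  B *m spectral_fun (fun x => if 0 < x then 1 else 0) Ud = B.
Proof.
move=> [_ pA] HUd AB; set P := spectral_fun _ _.
have AQ : A *m (1%:M - P) = 0.
  rewrite -(spectral_fun1 HUd) -{1}(spectral_fun_id HUd) spectral_funB (spectral_funM HUd).
  rewrite (@eq_spectral_fun _ _ _ _ (fun=> 0)) => [|i].
    rewrite /spectral_fun; set D := diag_mx _.
    have -> : D = 0 by apply/matrixP => i j; rewrite !mxE mul0rn.
    by rewrite mulmx0 mul0mx.
  have := spectral_ge0 HUd pA i; rewrite le_eqVlt => /orP[/eqP <-|->]; first by rewrite mul0r.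
  by rewrite subrr mulr0.
have BQ : B *m (1%:M - P) = 0.
  apply/matrixP => i j.
  have : B *m ((1%:M - P) *m (delta_mx j 0 : 'cV_n)) = 0.
    by apply: AB; rewrite mulmxA AQ mul0mx.
  by rewrite mulmxA -colE => /matrixP /(_ i 0); rewrite !mxE.
by move: BQ; rewrite mulmxBr mulmx1 => /eqP; rewrite subr_eq0 => /eqP <-.
Qed.

Lemma scale_tensl m n r s c (A : 'M[C]_(m, n)) (B : 'M[C]_(r, s)) :
  (c *: A) *t B = c *: (A *t B).
Proof. by apply/matrixP => i j; rewrite !mxE mulrA. Qed.

Lemma unitary_adj_comm n (W A : 'M[C]_n) : adj W *m W = 1%:M ->
  W *m A = A *m W -> adj W *m A = A *m adj W.
Proof.
move=> WW WA; have WW' := mulmx1C WW.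
rewrite -[LHS]mulmx1 -WW' mulmxA; congr (_ *m _).
by rewrite -mulmxA -WA mulmxA WW mul1mx.
Qed.

(** The estimate before optimising over [sigma]; under the kernel condition, the trace on the right
    is the quantity whose logarithm is [D2]. *)
Lemma decoupling_bound (n l dE : nat) (p : {poly 'F_2})
    (phi : 'M[C]_(2 ^ n * dE)) (sigma : 'M[C]_dE) (lam := maxn l (2 * n - l))
    (s := fun_mx (@inv_qrt R) ((1%:M : 'M[C]_(2 ^ n)) *t sigma)) :
  (l <= 2 * n)%N -> irreducible_poly p -> size p = lam.+1 ->
  phi = adj phi -> density sigma ->
  ker_sub ((1%:M : 'M[C]_(2 ^ n)) *t sigma) phi ->
  (2 ^ lam * 2 ^ (2 * n - l))%:R^-1 *
    \sum_(u : lam.-tuple bool) \sum_(v : (2 * n - l).-tuple bool)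
      trnorm (@Ruv R p n l dE u v phi
              - ((2 ^ n)%:R^-1 *: (1%:M : 'M[C]_(2 ^ n))) *t ptrA phi)
  <= Num.sqrt ((2 ^ n)%:R * ((2 ^ l)%:R^-1 * complex.Re (\tr ((s *m phi *m s) ^+ 2)))).
Proof.
move=> l2n p_irr p_size hphi [psigma trsigma] ker.
set m := (2 * n - l)%N.
have m_lam : (m <= lam)%N by rewrite leq_maxr.
have l_lam : (l <= lam)%N by rewrite leq_maxl.
set w := _ *t sigma in ker @s *.
have pw : psd w by exact: tens1_psd.
have [Ud HUd sE] := fun_mxP (@inv_qrt R) pw.1.
have {}sE : s = spectral_fun (@inv_qrt R) Ud by [].
pose h := spectral_fun (fun x : R => x `^ 4%:R^-1) Ud.
pose Q := spectral_fun (fun x : R => if 0 < x then 1 else 0) Ud.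
have hs : s = adj s by rewrite sE spectral_fun_adj.
have hh : h = adj h by rewrite spectral_fun_adj.
have hQ : Q = adj Q by rewrite spectral_fun_adj.
have shQ : s *m h = Q.
  by rewrite sE (spectral_funM HUd); apply: eq_spectral_fun => i; rewrite inv_qrt_mul.
have hsQ : h *m s = Q by rewrite hQ -shQ adj_mul -hs -hh.
(* The kernel condition enters here: [phi] lives on the support of [w], where [h] undoes [s]. *)
have phiQ : phi *m Q = phi by exact: ker_sub_proj pw HUd ker.
have Qphi : Q *m phi = phi by rewrite [in LHS]hphi hQ -adj_mul phiQ -hphi.
have hhw : (h *m h) *m (h *m h) = w.
  rewrite !(spectral_funM HUd) -[RHS](spectral_fun_id HUd).
  by apply: eq_spectral_fun => i; rewrite qrt_pow4 // (spectral_ge0 HUd pw.2).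
have ip_hh : ip (h *m h) (h *m h) = (2 ^ n)%:R.
  rewrite /ip adj_mul -hh hhw tr_tens1 trsigma mulr1.
  by rewrite -(rmorph_nat (real_complex R)).
have Wh beta : Ubeta_tens1 R n dE beta *m h = h *m Ubeta_tens1 R n dE beta.
  by apply: (spectral_fun_comm HUd); rewrite /w Ubeta_tens1_comm.
have Wh' beta : adj (Ubeta_tens1 R n dE beta) *m h = h *m adj (Ubeta_tens1 R n dE beta).
  exact: unitary_adj_comm (Ubeta_tens1_unitary _ _ _ _) (Wh _).
clearbody s h Q.
pose G k q := Fbeta (k ++ q) (s *m phi *m s).
pose c := ip (s *m phi *m s) (s *m phi *m s).
(* [h] commutes with the Pauli operators, so it moves inside and cancels [s] up to [Q], which [phi]
   absorbs. *)
have GF beta : h *m Fbeta beta (s *m phi *m s) *m h = Fbeta beta phi.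
  rewrite !FbetaE -!mulmxA Wh' !mulmxA -Wh -[_ *m h *m s]mulmxA hsQ.
  by rewrite -[_ *m Q *m phi]mulmxA Qphi -[_ *m s *m h]mulmxA shQ -[_ *m phi *m Q]mulmxA phiQ.
have Gc k q : ip (G k q) (G k q) = c.
  rewrite /G FbetaE; set X := s *m phi *m s; set W := Ubeta_tens1 _ _ _ _.
  have WW : adj W *m W = 1%:M by exact: Ubeta_tens1_unitary.
  rewrite ip_mulr adjK -mulmxA WW mulmx1 ip_mull mulmxA WW mul1mx.
  by [].
have cE : c = complex.Re (\tr ((s *m phi *m s) ^+ 2)).
  rewrite /c /ip; have -> : adj (s *m phi *m s) = s *m phi *m s; last by [].
  by rewrite !adj_mul -hs -hphi mulmxA.
rewrite -cE.
pose D := deviation l m p G.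
have DE (u : lam.-tuple bool) (v : m.-tuple bool) :
    @Ruv R p n l dE u v phi - ((2 ^ n)%:R^-1 *: (1%:M : 'M[C]_(2 ^ n))) *t ptrA phi =
    h *m D u v *m h.
  rewrite /D /deviation mulmxBr mulmxBl -!scalemxAr -!scalemxAl !invnatC.
  congr (_ - _).
    rewrite /Ruv mulmx_sumr mulmx_suml; congr (_ *: _); apply: eq_bigr => k _.
    by rewrite GF.
  have -> : h *m (\sum_(k : l.-tuple bool) \sum_(q : m.-tuple bool) G k q) *m h =
      (2 ^ n)%:R *: ((1%:M : 'M[C]_(2 ^ n)) *t ptrA phi).
    rewrite -sum_Fbeta mulmx_sumr mulmx_suml.
    transitivity (\sum_(k : l.-tuple bool) \sum_(q : m.-tuple bool) Fbeta (k ++ q) phi).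
      apply: eq_bigr => k _; rewrite mulmx_sumr mulmx_suml.
      by apply: eq_bigr => q _; rewrite GF.
    (* Since [l + m = 2n], the strings [k ++ q] run through all [2n]-bit strings, as in the full
       twirl. *)
    rewrite -(sum_tuple_cat n n (fun b => Fbeta b phi)).
    rewrite -(sum_tuple_cat l m (fun b => Fbeta b phi)).
    by have -> : (l + m = n + n)%N by rewrite /m; lia.
  rewrite scalerA scale_tensl; congr (_ *: _).
  have -> : (l + m = n + n)%N by rewrite /m; lia.
  by rewrite expnD natrM invfM -mulrA mulVf ?mulr1 //.
have le1 : \sum_(u : lam.-tuple bool) \sum_(v : m.-tuple bool)
      trnorm (@Ruv R p n l dE u v phi - ((2 ^ n)%:R^-1 *: (1%:M : 'M[C]_(2 ^ n))) *t ptrA phi)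
    <= \sum_(uv : lam.-tuple bool * m.-tuple bool)
         Num.sqrt ((2 ^ n)%:R * ip (D uv.1 uv.2) (D uv.1 uv.2)).
  rewrite pair_big /=; apply: ler_sum => -[u v] _ /=.
  by rewrite -ip_hh; apply: trnorm_sandwich_le (DE u v).
have cardN : #|{: lam.-tuple bool * m.-tuple bool}| = (2 ^ lam * 2 ^ m)%N.
  by rewrite card_prod !card_tuple card_bool.
have N0 : (0 < 2 ^ lam * 2 ^ m)%N by rewrite muln_gt0 !expn_gt0.
apply: le_trans (ler_wpM2l _ le1) _; first by rewrite invr_ge0 ler0n.
rewrite -cardN.
(* Concavity moves the mean under the root, where the variance bound applies. *)
apply: le_trans (mean_sqrt_le _ _) _; first by rewrite cardN.
  by move=> uv; rewrite mulr_ge0 ?ler0n ?ip_ge0.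
apply: ler_wsqrtr; rewrite cardN -mulr_sumr mulrCA ler_wpM2l ?ler0n //.
rewrite ler_pdivrMl ?ltr0n //.
by have := hash_variance p_irr p_size m_lam l_lam Gc; rewrite pair_big.
Qed.
End Smoothing.

(** * Binary logarithms and the infimum over states on E *)

Lemma powR2_log2 (R : realType) (x : R) : 0 < x -> 2 `^ log2 x = x.
Proof.
move=> x0; rewrite /powR pnatr_eq0 /= /log2 divfK ?lnK //.
by rewrite gt_eqF // ln_gt0 // ltr1n.
Qed.

Lemma le_log2 (R : realType) (x y : R) : 0 < x -> x <= y -> log2 x <= log2 y.
Proof.
move=> x0 xy; rewrite ler_pM2r ?invr_gt0 ?ln_gt0 ?ltr1n //.
by rewrite ler_ln // posrE (lt_le_trans x0).
Qed.

(** The maximally mixed state has trivial kernel; it shows that the infimum in [H2] is below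
    [+oo]. *)
Lemma exists_density_ker_sub (R : realType) dA dE (phi : 'M[R[i]]_(dA * dE)) :
  (0 < dE)%N ->
  exists2 sigma : 'M[R[i]]_dE, density sigma & ker_sub ((1%:M : 'M[R[i]]_dA) *t sigma) phi.
Proof.
move=> dE0; have nz : dE%:R != 0 :> R[i] by rewrite pnatr_eq0 -lt0n.
exists (dE%:R^-1)%:M; first split; first split.
- rewrite -scalemx1 adjZ adj_id; congr (_ *: _).
  by rewrite -invnatC conjc_real.
- move=> v; rewrite mul_mx_scalar -scalemxAl mxE mulr_ge0 ?invr_ge0 ?ler0n //.
  by have := @gram_ge0 R _ _ 1%:M v; rewrite adj_id mulmx1 mulmx1.
- by rewrite mxtrace_scalar -[X in X = _]mulr_natr mulVf.
move=> v; have -> : (1%:M : 'M[R[i]]_dA) *t ((dE%:R^-1)%:M : 'M[R[i]]_dE) =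
    dE%:R^-1 *: 1%:M.
  rewrite -(tensmx11 R dA dE); apply/matrixP => x y; rewrite !mxE mulrCA.
  by rewrite mulr_natr.
rewrite -scalemxAl mul1mx => /eqP; rewrite scaler_eq0 invr_eq0 (negPf nz) /=.
by move=> /eqP ->; rewrite mulmx0.
Qed.

Theorem theorem3 (R : realType) (n l dE : nat) (p : {poly 'F_2})
    (phi : 'M[R[i]]_(2 ^ n * dE)) :
  (1 <= n)%N -> (l <= 2 * n)%N ->
  irreducible_poly p -> size p = (maxn l (2 * n - l)).+1 ->
  density phi ->
  let lam := maxn l (2 * n - l) in
  (2 ^ lam * 2 ^ (2 * n - l))%:R^-1 *
    \sum_(u : lam.-tuple bool) \sum_(v : (2 * n - l).-tuple bool)
      trnorm (@Ruv R p n l dE u v phi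
              - ((2 ^ n)%:R^-1 *: (1%:M : 'M[R[i]]_(2 ^ n))) *t ptrA phi)
  <= Num.sqrt (2 `^ (n%:R - l%:R - fine (H2 phi))).
Proof.
move=> _ l2n p_irr p_size [[hphi _] trphi] /=.
set x := _ * (\sum_u _).
(* For [dE = 0] the trace would be an empty sum, not 1. *)
have dE0 : (0 < dE)%N.
  rewrite lt0n; apply/eqP => dE0; move: trphi; rewrite /mxtrace big1 ?[0 == 1]eqxx.
    by move=> /esym /eqP; rewrite oner_eq0.
  by move=> i; have := ltn_ord i; rewrite {2}dE0 muln0.
(* If [x > 0], the bounds for all [sigma] give a common lower bound on [D2], so the infimum
   is finite and [fine] returns its actual value. *)
have [x0|x0] := leP x 0; first exact: le_trans x0 (sqrtr_ge0 _).
(* [z] solves [x^2 = 2^(n-l) z]: the bound for each [sigma] then says that [z] is at most the trace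
   inside [D2]. *)
pose z := x ^+ 2 / ((2 ^ n)%:R / (2 ^ l)%:R).
have r0 : 0 < (2 ^ n)%:R / (2 ^ l)%:R :> R by rewrite divr_gt0 // ltr0n expn_gt0.
have z0 : 0 < z by rewrite divr_gt0 // exprn_gt0.
have D2_ge sigma : density sigma ->
    ((log2 z)%:E <= D2 phi ((1%:M : 'M[R[i]]_(2 ^ n)) *t sigma))%E.
  move=> dsigma; rewrite /D2; case: pselect => [ker|nker] /=; last exact: leey.
  rewrite lee_fin; apply: le_log2 => //.
  have := decoupling_bound l2n p_irr p_size hphi dsigma ker; rewrite -/x.
  set y := complex.Re _ => xy.
  have := xy; rewrite -(ler_pXn2r (ltn0Sn 1)) ?nnegrE ?sqrtr_ge0 ?(ltW x0) // => x2y.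
  (* A negative radicand would have root 0 by convention, contradicting [0 < x]. *)
  have y0 : 0 <= (2 ^ n)%:R * ((2 ^ l)%:R^-1 * y).
    rewrite leNgt; apply/negP => /ltW y0; move: xy; rewrite ler0_sqrtr //.
    by rewrite leNgt x0.
  by rewrite /z ler_pdivrMr // [X in _ <= X]mulrC -mulrA (le_trans x2y) // sqr_sqrtr.
rewrite /H2; set S := [set _ | _ in _]%classic.
have lbS : ((log2 z)%:E <= ereal_inf S)%E.
  by apply: le_ereal_inf_tmp => _ [sigma dsigma <-]; exact: D2_ge.
have ubS : (ereal_inf S < +oo)%E.
  have [sigma dsigma ker] := exists_density_ker_sub phi dE0.
  apply: (@le_lt_trans _ _ (D2 phi ((1%:M : 'M[R[i]]_(2 ^ n)) *t sigma))).
    by apply: ereal_inf_lbound; exists sigma.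
  by rewrite /D2; case: pselect => [ker'|] /=; first exact: ltry.
(* The two bounds exclude infinite values, so [e] is the infimum and [fine (H2 phi)] is [- e]. *)
case: (ereal_inf S) lbS ubS => // e; rewrite lee_fin => ze _ /=.
rewrite opprK -(ger0_norm (ltW x0)) -sqrtr_sqr; apply: ler_wsqrtr.
have -> : x ^+ 2 = (2 ^ n)%:R / (2 ^ l)%:R * z by rewrite mulrC divfK // gt_eqF.
have two (k : nat) : (2 ^ k)%:R = 2 `^ k%:R :> R by rewrite powR_mulrn // natrX.
have ne (a b : R) : (a + b == 0) ==> (2 != 0 :> R) by rewrite pnatr_eq0 implybT.
rewrite !powRD // powRN -!two; apply: ler_wpM2l; first exact: ltW.
by rewrite -{1}(powR2_log2 z0) ler_powR // ler1n.
Qed.
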